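(* Let $A\subset \mathbb{R}^p$ be a self-similar fractal defined by similitudes $\{\psi_m\}_{m=1}^M$ with contraction ratios $\{r_m\}_{m=1}^M$. Assume that there are $r\in(0,1)$ and positive integers $i_1,\ldots,i_M$ with no common factor (i.e. $\gcd(i_1,\ldots,i_M)=1$) such that $r_k=r^{i_k}$ for every $k=1,\ldots,M$. Let $d$ be the Hausdorff dimension of $A$, and for every $\ell\in\mathbb{N}$ (positive integer) let $\mathcal{N}_\ell:=\{\lfloor \ell\cdot r^{-nd}\rfloor : n\in\mathbb{N}\}$. Then, for every $s>d$ and every $\ell\in\mathbb{N}$, the limit $$\lim_{\substack{N\to\infty\\ N\in\mathcal{N}_\ell}}\frac{\mathcal{E}_s(A,N)}{N^{1+s/d}}$$ exists.
   Context: A similitude with contraction ratio $0<\rho<1$ is a map $\psi:\mathbb{R}^p\to\mathbb{R}^p$ of the form $\psi(x)=\rho\, O(x)+z$ with $O$ an orthogonal $p\times p$ matrix and $z\in\mathbb{R}^p$. A (nonempty) compact set $A\subset\mathbb{R}^p$ is a self-similar fractal defined by similitudes $\{\psi_m\}_{m=1}^M$ ($M\geq 2$) with contraction ratios $\{r_m\}_{m=1}^M$ if $A=\bigcup_{m=1}^M\psi_m(A)$, where the union is disjoint (the sets $\psi_m(A)$ are pairwise disjoint). The Hausdorff dimension $d$ of such $A$ is the number satisfying $\sum_{m=1}^M r_m^d=1$. For $s>0$ and an integer $N\geq 2$, the minimal discrete Riesz $s$-energy is $$\mathcal{E}_s(A,N):=\inf_{\omega_N}E_s(\omega_N),\qquad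 E_s(\omega_N):=\sum_{i\neq j}|x_i-x_j|^{-s},$$ where the infimum is over all sets $\omega_N=\{x_1,\ldots,x_N\}\subset A$ of $N$ distinct points, the sum is over ordered pairs $(i,j)$ with $i\ne j$, and $|\cdot|$ is the Euclidean norm. *)

(* Defs.v *)
From HB Require Import structures.
From mathcomp Require Import all_boot all_order all_algebra.
From mathcomp Require Import all_classical all_reals all_analysis.

Set Implicit Arguments.
Unset Strict Implicit.
Unset Printing Implicit Defensive.

Import Order.TTheory GRing.Theory Num.Theory.
Import numFieldNormedType.Exports.

Local Open Scope classical_set_scope.
Local Open Scope ring_scope.

(* The library norm `|x| on matrices is the sup norm, hence this definition.
   Both norms induce the same topology, so [compact] below is unaffected. *)
Definition eucl_norm (R : realType) (p : nat) (x : 'cV[R]_p) : R :=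
  Num.sqrt (\sum_(i < p) x i 0 ^+ 2).

Definition orthogonal_mx (R : realType) (p : nat) (O : 'M[R]_p) : Prop :=
  O^T *m O = 1%:M.

Definition similitude (R : realType) (p : nat) (rho : R)
    (psi : 'cV[R]_p -> 'cV[R]_p) : Prop :=
  0 < rho < 1 /\
  exists (O : 'M[R]_p) (z : 'cV[R]_p),
    orthogonal_mx O /\ forall x, psi x = rho *: (O *m x) + z.

Definition self_similar_fractal (R : realType) (p M : nat)
    (psi : 'I_M -> 'cV[R]_p -> 'cV[R]_p) (r : 'I_M -> R)
    (A : set 'cV[R]_p) : Prop :=
  (2 <= M)%N /\
  (forall m, similitude (r m) (psi m)) /\
  A !=set0 /\
  compact A /\
  A = \bigcup_(m in [set: 'I_M]) (psi m @` A) /\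
  trivIset [set: 'I_M] (fun m => psi m @` A).

(* The Hausdorff dimension of a self-similar fractal, given by the Moran
   equation; its solution is unique because M >= 2 and 0 < r m < 1. *)
Definition is_fractal_dimension (R : realType) (M : nat) (r : 'I_M -> R)
    (d : R) : Prop :=
  \sum_(m < M) r m `^ d = 1.

Definition riesz_energy (R : realType) (p : nat) (s : R) (N : nat)
    (x : 'I_N -> 'cV[R]_p) : R :=
  \sum_(i < N) \sum_(j < N | j != i) eucl_norm (x i - x j) `^ (- s).

(* An N-point subset of A is represented by an injective enumeration, on which
   the energy does not depend.  The real-valued [inf] of the empty set is 0,
   but a self-similar fractal is infinite, so it has N-point subsets for all N. *)
Definition min_riesz_energy (R : realType) (p : nat) (s : R)
    (A : set 'cV[R]_p) (N : nat) : R :=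
  inf [set E | exists x : 'I_N -> 'cV[R]_p,
         [/\ injective x, (forall i, A (x i)) & E = riesz_energy s x]].

(* [Num.truncn] is the nat-valued floor on nonnegative reals; n ranges over
   the positive integers. *)
Definition scale_set (R : realType) (r d : R) (l : nat) : set nat :=
  [set Num.truncn (l%:R * r `^ (- (n%:R * d))) | n in [set n : nat | (0 < n)%N]].

(* Main.v *)
Require Import Defs.
From HB Require Import structures.
From mathcomp Require Import all_boot all_order all_algebra.
From mathcomp Require Import all_classical all_reals all_analysis.
From mathcomp Require Import ring lra zify.

Import Order.TTheory GRing.Theory Num.Theory.
Import numFieldNormedType.Exports.

Local Open Scope classical_set_scope.
Local Open Scope ring_scope.

(* Write E N for the minimal energy, N_n = floor (l r^(-nd)) and
   F n = r^(n(d+s)) E N_n, which is E N_n / N_n^(1+s/d) up to a factor tending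
   to l^(1+s/d).  Putting near-minimal configurations of N_(n - i_m) points into
   the pieces psi_m(A) uses at most N_n points and misses at most M of them.
   The interaction between different pieces is O(N_n^2) because they are
   separated, and a missing point can be added at cost o(N_n^(1+s/d)) by
   choosing it where the potential of the others is small.  After scaling this
   reads
     F n <= sum_m r_m^d F (n - i_m) + O(q^n)   with q < 1,
   where the weights r_m^d sum to 1: a renewal inequality.  Since the i_m have
   gcd 1, a value of F below the limsup would push down all values sufficiently
   far ahead by a fixed fraction of its defect; hence F converges.  No lower
   bound on the energy is needed besides E >= 0. *)

(** * Renewal inequalities *)

Section NumericalSemigroup.
Local Open Scope nat_scope.
Variable P : nat -> Prop.
Hypothesis P0 : P 0.
Hypothesis PD : forall a b, P a -> P b -> P (a + b).

Lemma addn_closed_mul (k a : nat) : P a -> P (k * a).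
Proof.
move=> Pa; elim: k => [|k IH]; first by rewrite mul0n.
by rewrite mulSn; exact: PD.
Qed.

(** Differences of elements of [P] are stable under gcd: with u a = v b + gcd a b, the elements u x
    + v (y + b) and u (x + a) + v y of [P] differ by gcd a b. *)
Lemma addn_closed_gcd_difference (M : nat) (i : 'I_M -> nat) :
  (forall m, P (i m)) ->
  exists x, P x /\ P (x + \big[gcdn/0]_(m < M) i m).
Proof.
move=> Pi; apply: (big_ind (fun g => exists x, P x /\ P (x + g))).
- by exists 0; rewrite addn0.
- move=> a b [x [Px Pxa]] [y [Py Pyb]].
  have [->|a_gt0] := posnP a; first by exists y; rewrite gcd0n.
  case: (egcdnP b a_gt0) => u v uv _.
  exists (u * x + v * (y + b)); split.
    by apply: PD; exact: addn_closed_mul.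
  have -> : u * x + v * (y + b) + gcdn a b = u * (x + a) + v * y.
    by rewrite !mulnDr uv; ring.
  by apply: PD; exact: addn_closed_mul.
- by move=> m _; exists 0; split; [exact: P0 | exact: Pi].
Qed.

(** With x and x + 1 in [P], a number k = q x + t with t <= q equals (q - t) x + t (x + 1). From x^2
    on, the quotient q is at least x and so exceeds the remainder t. *)
Lemma addn_closed_cofinite (M : nat) (i : 'I_M -> nat) :
  (forall m, P (i m)) -> \big[gcdn/0]_(m < M) i m = 1 ->
  exists K, forall k, K <= k -> P k.
Proof.
move=> Pi gcd1; have [x [Px]] := addn_closed_gcd_difference M i Pi.
rewrite gcd1 => Px1; exists (x * x) => k le_k.
have [x0|x_gt0] := posnP x.
  by rewrite -[k]muln1; apply: addn_closed_mul; rewrite x0 in Px1.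
have le_q : x <= k %/ x by rewrite leq_divRL.
have lt_r : k %% x < x by rewrite ltn_mod.
have -> : k = (k %/ x - k %% x) * x + (k %% x) * (x + 1).
  have le_rq : k %% x <= k %/ x by exact: ltnW (leq_trans lt_r le_q).
  rewrite mulnBl mulnDr muln1 addnA subnK ?leq_mul2r ?le_rq ?orbT //.
  exact: divn_eq.
by apply: PD; exact: addn_closed_mul.
Qed.

End NumericalSemigroup.

(** * Convergence under a renewal inequality *)

Section Renewal.
Variables (R : realType) (M : nat) (w : 'I_M -> R) (i : 'I_M -> nat).
Hypothesis w_gt0 : forall m, 0 < w m.
Hypothesis w_sum1 : \sum_(m < M) w m = 1.
Hypothesis i_gt0 : forall m, (0 < i m)%N.
Hypothesis i_gcd1 : \big[gcdn/0%N]_(m < M) i m = 1%N.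

Local Notation I := (\max_(m < M) i m)%N.

Lemma leiI m : (i m <= I)%N.
Proof. exact: leq_bigmax. Qed.

Lemma I_gt0 : (0 < I)%N.
Proof.
case: (posnP I) => // I0; move: w_sum1; rewrite big1 => [/esym/eqP|m _].
  by rewrite oner_eq0.
by move: (i_gt0 m) (leiI m); rewrite I0 => /leq_trans/[apply].
Qed.

Section NoError.
Variable G : nat -> R.
Hypothesis G_ge0 : forall n, 0 <= G n.
Hypothesis G_le : forall n, (I <= n)%N ->
  G n <= \sum_(m < M) w m * G (n - i m)%N.

(* A value of G below an upper bound U propagates to the index k later with
   the fraction c of its defect. *)
Definition propagates (k : nat) (c : R) := forall (n : nat) (U : R),
  (forall j, (n <= j)%N -> G j <= U) ->
  forall h, (n + I <= h)%N -> G (h + k)%N <= U - c * (U - G h).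

Lemma propagates_le k c c' : c' <= c -> propagates k c -> propagates k c'.
Proof.
move=> le_c Pk n U GU h le_h; apply: (le_trans (Pk n U GU h le_h)).
by rewrite lerD2l lerN2 ler_wpM2r // subr_ge0 GU //; lia.
Qed.

Lemma propagatesD j k c c' : 0 <= c' -> propagates j c -> propagates k c' ->
  propagates (j + k) (c' * c).
Proof.
move=> c'0 Pj Pk n U GU h le_h; rewrite addnA.
have le_hj : (n + I <= h + j)%N by lia.
apply: (le_trans (Pk n U GU _ le_hj)).
rewrite lerD2l lerN2 -mulrA ler_wpM2l //.
by have := Pj n U GU h le_h; lra.
Qed.

(** In the renewal inequality at h + i m the m-th term is [w m * G h]; the others are bounded
    through U and carry the total weight 1 - w m. *)
Lemma propagates_step m : propagates (i m) (w m).
Proof.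
move=> n U GU h le_h.
have leI := leiI m.
apply: (le_trans (G_le _ _)); first by lia.
rewrite (bigD1 m) //= addnK.
have -> : U - w m * (U - G h) = w m * G h + (1 - w m) * U by ring.
rewrite lerD2l.
have -> : 1 - w m = \sum_(m' < M | m' != m) w m'.
  by rewrite -w_sum1 (bigD1 m) //= addrAC subrr add0r.
rewrite mulr_suml.
(* Since h >= n + I, every index h + i m - i m' is at least n, where U bounds G. *)
apply: ler_sum => m' _; rewrite ler_wpM2l ?(ltW (w_gt0 _)) // GU //.
by have := leiI m'; lia.
Qed.

(** The delays that propagate with some positive fraction are closed under addition and contain
    every i m, so gcd 1 yields all large delays. For a window of I of them, the least fraction
    serves all. *)
Lemma uniform_propagation : exists (K : nat) (c : R),
  0 < c /\ forall k, (k < I)%N -> propagates (K + k) c.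
Proof.
pose P k := exists2 c : R, 0 < c & propagates k c.
have P0 : P 0%N.
  by exists 1 => // n U GU h _; rewrite addn0; lra.
have PD a b : P a -> P b -> P (a + b)%N.
  move=> [c c0 Pa] [c' c'0 Pb]; exists (c' * c); first exact: mulr_gt0.
  exact: propagatesD (ltW c'0) Pa Pb.
have Pi m : P (i m) by exists (w m) => //; exact: propagates_step.
have [K PK] := addn_closed_cofinite P P0 PD M i Pi i_gcd1.
exists K; elim: I => [|J [c [c0 Pc]]]; first by exists 1.
have [c' c'0 Pc'] := PK (K + J)%N (leq_addr _ _).
exists (Num.min c c'); split; first by rewrite lt_min c0.
move=> k; rewrite ltnS leq_eqVlt => /predU1P[->|lt_k].
  by apply: (propagates_le _ c') => //; rewrite ge_min lexx orbT.
by apply: (propagates_le _ c (Num.min c c') _ (Pc k lt_k)); rewrite ge_min lexx.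
Qed.

Definition window_max n := \big[Num.max/0]_(k < I) G (n + k)%N.

Lemma G_le_window_max n k : (k < I)%N -> G (n + k)%N <= window_max n.
Proof. by move=> lt_k; apply: (le_bigmax _ _ (Ordinal lt_k)). Qed.

(** The only new value in the next window is G (n + I), which is bounded by a weighted mean of
    values in the old window. *)
Lemma window_max_le n : window_max n.+1 <= window_max n.
Proof.
(* The maximum has default 0, which must lie below the bound as well. *)
rewrite /window_max; apply: bigmax_le => [|k _].
  exact: le_trans (G_ge0 _) (G_le_window_max n 0%N I_gt0).
have [lt_k|ge_k] := ltnP k.+1 I.
  by rewrite addSnnS; exact: G_le_window_max.
have -> : (n.+1 + k = n + I)%N by have := ltn_ord k; lia.
apply: (le_trans (G_le _ (leq_addl _ _))).
rewrite -[leRHS]mul1r -w_sum1 mulr_suml; apply: ler_sum => m _.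
rewrite ler_wpM2l ?(ltW (w_gt0 _)) // -addnBA ?leiI //; apply: G_le_window_max.
by have := i_gt0 m; have := I_gt0; lia.
Qed.

Lemma window_max_ge0 n : 0 <= window_max n.
Proof. exact: le_trans (G_ge0 _) (G_le_window_max n 0%N I_gt0). Qed.

Lemma window_max_nonincreasing : nonincreasing_seq window_max.
Proof. by apply/nonincreasing_seqP; exact: window_max_le. Qed.

Lemma G_le_window_max_later n j : (n <= j)%N -> G j <= window_max n.
Proof.
move=> le_j; apply: le_trans (window_max_nonincreasing _ _ le_j).
by rewrite -[X in G X]addn0; exact: (G_le_window_max j 0%N I_gt0).
Qed.

(** The window maxima decrease to a limit L. If G (n + I) is e below [window_max n], the whole
    window from n + I + K on is at least c e below it, so L <= window_max n - c e. Hence e <=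
    (window_max n - L) / c, which tends to 0. *)
Lemma subrenewal_cvg : cvgn G.
Proof.
have window_max_cvg : cvgn window_max.
  apply: nonincreasing_is_cvgn; first exact: window_max_nonincreasing.
  by exists 0 => _ [n _ <-]; exact: window_max_ge0.
set L := limn window_max.
have L_le n : L <= window_max n.
  by apply: nonincreasing_cvgn_ge => //; exact: window_max_nonincreasing.
have [K [c [c0 Pc]]] := uniform_propagation.
apply/cvg_ex; exists L; rewrite -(cvg_shiftn I).
have lowL : (fun n => window_max n - (window_max n - L) / c) @ \oo --> L.
  rewrite -[X in _ --> X](subr0 L) -(mul0r c^-1) -[X in X / c](subrr L).
  apply: cvgB => //; apply: cvgMr_tmp; apply: cvgB => //; exact: cvg_cst.
apply: (squeeze_cvgr _ lowL window_max_cvg).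
near=> n; apply/andP; split; last first.
  by apply: G_le_window_max_later; exact: leq_addr.
have : L <= window_max n - c * (window_max n - G (n + I)%N).
  apply: (le_trans (L_le (n + I + K)%N)); rewrite /window_max; apply: bigmax_le.
    apply: le_trans (G_ge0 (n + I + (K + 0))%N) _.
    by apply: (Pc 0%N I_gt0 n) => // j; exact: G_le_window_max_later.
  move=> k _; rewrite -addnA.
  by apply: (Pc k (ltn_ord k) n) => // j; exact: G_le_window_max_later.
move=> le_L.
suff : window_max n - G (n + I)%N <= (window_max n - L) / c.
  move=> le_SG.
  by change (window_max n - (window_max n - L) / c <= G (n + I)%N); lra.
by rewrite ler_pdivlMr // mulrC; lra.
Unshelve. all: by end_near.
Qed.

End NoError.

(* Adding the multiple K q^n of the error, with K / q - K = B, turns the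
   inequality into one without error. *)
Lemma subrenewal_geometric_cvg (F : nat -> R) (B q : R) :
  0 <= B -> 0 < q < 1 -> (forall n, 0 <= F n) ->
  (forall n, (I <= n)%N ->
     F n <= \sum_(m < M) w m * F (n - i m)%N + B * q ^+ n) ->
  cvgn F.
Proof.
move=> B0 /andP[q0 q1] F0 F_le.
pose K := B * q / (1 - q).
have K0 : 0 <= K by rewrite /K divr_ge0 ?mulr_ge0 ?subr_ge0 // ltW.
have KB : K = (K + B) * q by rewrite /K; field; lra.
have qK_cvg : (fun n => K * q ^+ n) @ \oo --> (0 : R).
  rewrite -(mulr0 K); apply: cvgMl_tmp.
  by apply: cvg_expr; rewrite ger0_norm // ltW.
have : cvgn (fun n => F n + K * q ^+ n).
  apply: subrenewal_cvg => [n|n leIn].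
    by rewrite addr_ge0 // mulr_ge0 // exprn_ge0 // ltW.
  under eq_bigr do rewrite mulrDr; rewrite big_split /=.
  apply: (le_trans (lerD (F_le n leIn) (lexx _))); rewrite -addrA lerD2l.
  rewrite -mulrDl addrC -[leLHS]mul1r -w_sum1 mulr_suml; apply: ler_sum => m _.
  (* K q^(n - i m) = (K + B) q^(n - i m + 1), and i m >= 1 makes this at least (K + B) q^n. *)
  rewrite ler_wpM2l ?(ltW (w_gt0 _)) // {2}KB -mulrA -exprS.
  rewrite ler_wpM2l ?addr_ge0 // ler_wiXn2l ?(ltW q0) ?(ltW q1) //.
  by have := i_gt0 m; have := leiI m; lia.
move=> /cvg_ex[/= L FK]; apply/cvg_ex; exists L.
have -> : F = (fun n => (F n + K * q ^+ n) - K * q ^+ n).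
  by apply/funext => n; rewrite addrK.
by rewrite -(subr0 L); exact: cvgB.
Qed.

End Renewal.

(** * Similitudes *)

Section EuclideanNorm.
Variables (R : realType) (p : nat).
Implicit Types x y : 'cV[R]_p.

Lemma eucl_norm_ge0 x : 0 <= eucl_norm x.
Proof. exact: sqrtr_ge0. Qed.

Lemma eucl_norm0 : eucl_norm (0 : 'cV[R]_p) = 0.
Proof.
by rewrite /eucl_norm big1 ?sqrtr0 // => k _; rewrite mxE expr0n.
Qed.

Lemma eucl_norm_subC x y : eucl_norm (x - y) = eucl_norm (y - x).
Proof.
congr Num.sqrt; apply: eq_bigr => k _.
by rewrite -opprB mxE sqrrN.
Qed.

Lemma eucl_normE x : eucl_norm x = Num.sqrt ((x^T *m x) 0 0).
Proof.
by congr Num.sqrt; rewrite mxE; apply: eq_bigr => k _; rewrite !mxE expr2.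
Qed.

Lemma eucl_norm_orthogonal (O : 'M[R]_p) x :
  orthogonal_mx O -> eucl_norm (O *m x) = eucl_norm x.
Proof.
move=> OO; rewrite !eucl_normE trmx_mul mulmxA -(mulmxA x^T).
by rewrite OO mulmx1.
Qed.

Lemma eucl_normZ (a : R) x : 0 <= a -> eucl_norm (a *: x) = a * eucl_norm x.
Proof.
move=> a0; rewrite !eucl_normE -scalemxAr linearZ /= -scalemxAl scalerA mxE.
by rewrite sqrtrM ?mulr_ge0 // -expr2 sqrtr_sqr ger0_norm.
Qed.

Lemma eucl_norm_le0 x : eucl_norm x <= 0 -> x = 0.
Proof.
rewrite le_eqVlt ltNge eucl_norm_ge0 orbF sqrtr_eq0 => le0.
have sum0 : \sum_(k < p) x k 0 ^+ 2 = 0.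
  by apply/eqP; rewrite eq_le le0 sumr_ge0 // => k _; exact: sqr_ge0.
apply/colP => k; rewrite mxE; apply/eqP; rewrite -sqrf_eq0.
by apply/eqP; apply: (psumr_eq0P _ sum0) => // j _; exact: sqr_ge0.
Qed.

Lemma similitude_dist (rho : R) (psi : 'cV[R]_p -> 'cV[R]_p) x y :
  similitude rho psi -> eucl_norm (psi x - psi y) = rho * eucl_norm (x - y).
Proof.
move=> [/andP[rho0 _] [ O [z [OO psiE]]]].
rewrite !psiE opprD addrACA subrr addr0 -scalerBr -mulmxBr.
by rewrite eucl_normZ ?ltW // eucl_norm_orthogonal.
Qed.

Lemma cvg_sum_ord (n : nat) (T : Type) (F : set_system T) (f : 'I_n -> T -> R)
    (l : 'I_n -> R) : Filter F ->
  (forall k, f k t @[t --> F] --> l k) ->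
  \sum_(k < n) f k t @[t --> F] --> \sum_(k < n) l k.
Proof.
move=> FF fl; elim: (index_enum 'I_n) => [|k e IH].
  rewrite big_nil; under eq_fun do rewrite big_nil; exact: cvg_cst.
rewrite big_cons; under eq_fun do rewrite big_cons.
by apply: cvgD; [exact: fl | exact: IH].
Qed.

Lemma similitude_coord_cvg (rho : R) (psi : 'cV[R]_p -> 'cV[R]_p) (T : Type)
    (F : set_system T) (u : T -> 'cV[R]_p) x k : Filter F ->
  similitude rho psi -> (forall j, u t j 0 @[t --> F] --> x j 0) ->
  psi (u t) k 0 @[t --> F] --> psi x k 0.
Proof.
move=> FF [_ [ O [z [_ psiE]]]] ux.
have psi_coord y : psi y k 0 = rho * (\sum_(j < p) O k j * y j 0) + z k 0.
  by rewrite psiE !mxE.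
rewrite psi_coord; under eq_fun do rewrite psi_coord.
apply: cvgD; last exact: cvg_cst.
apply: cvgMl_tmp.
apply: (cvg_sum_ord _ _ _
  (fun j t => O k j * u t j 0) (fun j => O k j * x j 0)).
by move=> j; apply: cvgMl_tmp; exact: ux.
Qed.

(** The squared distance, a polynomial in the coordinates, is continuous and attains its minimum on
    the compact product of A with itself; disjointness makes that minimum nonzero. *)
Lemma similitude_images_separated (rho rho' : R)
    (psi psi' : 'cV[R]_p -> 'cV[R]_p) (A : set 'cV[R]_p) :
  similitude rho psi -> similitude rho' psi' -> compact A ->
  (forall x y, A x -> A y -> psi x <> psi' y) ->
  exists2 delta : R, 0 < delta &
    forall x y, A x -> A y -> delta <= eucl_norm (psi x - psi' y).
Proof.
move=> spsi spsi' cA disj.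
have [->|/set0P [a Aa]] := eqVneq A set0; first by exists 1.
pose f (w : 'cV[R]_p * 'cV[R]_p) : R :=
  \sum_(k < p) (psi w.1 k 0 - psi' w.2 k 0) ^+ 2.
have fE x y : eucl_norm (psi x - psi' y) = Num.sqrt (f (x, y)).
  by congr Num.sqrt; apply: eq_bigr => k _; rewrite !mxE.
have f_cont : continuous f.
  move=> [x y].
  have fst_cvg (j : 'I_p) : (w.1 : 'cV[R]_p) j 0 @[w --> nbhs (x, y)] --> x j 0.
    apply: (@cvg_comp _ _ _ fst (fun u : 'cV[R]_p => u j 0) _ (nbhs x)).
      exact: cvg_fst.
    exact: coord_continuous.
  have snd_cvg (j : 'I_p) : (w.2 : 'cV[R]_p) j 0 @[w --> nbhs (x, y)] --> y j 0.
    apply: (@cvg_comp _ _ _ snd (fun u : 'cV[R]_p => u j 0) _ (nbhs y)).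
      exact: cvg_snd.
    exact: coord_continuous.
  apply: (cvg_sum_ord _ _ _
    (fun k w => (psi w.1 k 0 - psi' w.2 k 0) ^+ 2)
    (fun k => (psi x k 0 - psi' y k 0) ^+ 2)) => k.
  have fk : psi w.1 k 0 - psi' w.2 k 0 @[w --> nbhs (x, y)]
      --> psi x k 0 - psi' y k 0.
    apply: cvgB.
      exact: (similitude_coord_cvg _ _ _ _ fst x k _ spsi fst_cvg).
    exact: (similitude_coord_cvg _ _ _ _ snd y k _ spsi' snd_cvg).
  by under eq_fun do rewrite expr2; rewrite expr2; exact: cvgM.
have AA0 : (A `*` A) !=set0 by exists (a, a).
have [[x y]] := compact_EVT_min AA0 (compact_setX cA cA)
  (continuous_subspaceT f_cont).
rewrite inE => -[/= Ax Ay] f_min; exists (Num.sqrt (f (x, y))).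
  rewrite -fE lt_neqAle eucl_norm_ge0 andbT eq_sym; apply/eqP => d0.
  apply: (disj x y) => //; apply/eqP; rewrite -subr_eq0; apply/eqP.
  by apply: eucl_norm_le0; rewrite d0.
by move=> x' y' Ax' Ay'; rewrite fE ler_wsqrtr // f_min // inE; split.
Qed.

(** The least separation over the finitely many pairs works. Diagonal pairs get the dummy value 1,
    so that one function on all pairs can be chosen. *)
Lemma fractal_pieces_separated (M : nat) (psi : 'I_M -> 'cV[R]_p -> 'cV[R]_p)
    (rm : 'I_M -> R) (A : set 'cV[R]_p) :
  self_similar_fractal psi rm A ->
  exists2 delta : R, 0 < delta &
    forall m m' x y, m != m' -> A x -> A y ->
      delta <= eucl_norm (psi m x - psi m' y).
Proof.
move=> [_ [spsi [_ [cA [_ disjA]]]]].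
have sep (mm : 'I_M * 'I_M) : exists delta : R, 0 < delta /\
    (mm.1 != mm.2 -> forall x y, A x -> A y ->
       delta <= eucl_norm (psi mm.1 x - psi mm.2 y)).
  have [eq_mm|neq_mm] := eqVneq mm.1 mm.2; first by exists 1.
  have [x y Ax Ay psi_xy|delta delta0 deltaP] :=
    similitude_images_separated _ _ _ _ A (spsi mm.1) (spsi mm.2) cA.
    move/eqP: neq_mm; apply; apply: disjA => //.
    by exists (psi mm.1 x); split; [exists x | exists y].
  by exists delta.
have [delta deltaP] := choice sep.
exists (\big[Num.min/1]_mm delta mm).
  by apply: lt_bigmin => // mm _; exact: (deltaP mm).1.
move=> m m' x y neq_m Ax Ay.
apply: le_trans ((deltaP (m, m')).2 neq_m x y Ax Ay).
exact: bigmin_le.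
Qed.

End EuclideanNorm.

(** * Energies on a self-similar fractal *)

Lemma powR_lt1 (R : realType) (x a : R) : 0 < x < 1 -> 0 < a -> x `^ a < 1.
Proof.
move=> /andP[x0 x1] a0; have : x `^ a < 1 `^ a.
  by apply: gt0_ltr_powR; rewrite ?nnegrE ?ler01 // ltW.
by rewrite powR1.
Qed.

Section FractalEnergy.
Variables (R : realType) (p M : nat) (A : set 'cV[R]_p).
Variables (psi : 'I_M -> 'cV[R]_p -> 'cV[R]_p) (rm : 'I_M -> R).
Variables (d s rho delta : R).
Hypothesis A_neq0 : A !=set0.
Hypothesis A_pieces : A = \bigcup_(m in [set: 'I_M]) (psi m @` A).
Hypothesis psi_dist : forall m x y,
  eucl_norm (psi m x - psi m y) = rm m * eucl_norm (x - y).
Hypothesis delta_gt0 : 0 < delta.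
Hypothesis psi_separated : forall m m' x y, m != m' -> A x -> A y ->
  delta <= eucl_norm (psi m x - psi m' y).
Hypothesis rm_gt0 : forall m, 0 < rm m.
Hypothesis rm_le : forall m, rm m <= rho.
Hypothesis rho01 : 0 < rho < 1.
Hypothesis moran : \sum_(m < M) rm m `^ d = 1.
Hypothesis d_gt0 : 0 < d.
Hypothesis lt_ds : d < s.

Lemma s_gt0 : 0 < s. Proof. exact: lt_trans d_gt0 lt_ds. Qed.
#[local] Hint Resolve s_gt0 : core.

Definition riesz (x y : 'cV[R]_p) : R := eucl_norm (x - y) `^ (- s).

Lemma riesz_ge0 x y : 0 <= riesz x y. Proof. exact: powR_ge0. Qed.
#[local] Hint Resolve riesz_ge0 : core.

Lemma rieszC x y : riesz x y = riesz y x.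
Proof. by rewrite /riesz eucl_norm_subC. Qed.

(* 0 `^ (- s) = 0, so the diagonal terms can be added to the energy. *)
Lemma riesz_diag x : riesz x x = 0.
Proof. by rewrite /riesz subrr eucl_norm0 powR0 // oppr_eq0 gt_eqF. Qed.

Lemma riesz_psi m x y : riesz (psi m x) (psi m y) = rm m `^ (- s) * riesz x y.
Proof. by rewrite /riesz psi_dist powRM ?eucl_norm_ge0 // ltW. Qed.

Local Notation D := (delta `^ (- s)).

Lemma riesz_separated m m' x y : m != m' -> A x -> A y ->
  riesz (psi m x) (psi m' y) <= D.
Proof.
move=> neq_m Ax Ay; have le_delta := psi_separated m m' x y neq_m Ax Ay.
have norm_gt0 := lt_le_trans delta_gt0 le_delta.
rewrite /riesz !powRN lef_pV2 ?posrE ?powR_gt0 //.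
by apply: ge0_ler_powR => //; rewrite ?nnegrE ltW.
Qed.

Lemma psi_inj m : injective (psi m).
Proof.
move=> x y psi_xy; apply/eqP; rewrite -subr_eq0; apply/eqP.
apply: eucl_norm_le0; rewrite -(pmulr_rle0 _ (rm_gt0 m)) -psi_dist psi_xy.
by rewrite subrr eucl_norm0.
Qed.

Lemma psiA m x : A x -> A (psi m x).
Proof. by move=> Ax; rewrite A_pieces; exists m => //; exists x. Qed.

Lemma A_psi x : A x -> exists m, exists2 a, A a & psi m a = x.
Proof. by rewrite {1}A_pieces => -[m _ [a Aa <-]]; exists m, a. Qed.

Lemma psi_disjoint m m' x y : A x -> A y -> psi m x = psi m' y -> m = m'.
Proof.
move=> Ax Ay psi_xy; apply/eqP; apply: contraT => neq_m.
have := psi_separated m m' x y neq_m Ax Ay.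
by rewrite psi_xy subrr eucl_norm0 leNgt delta_gt0.
Qed.

(* Any exponent tau >= 2 with s / d < tau < 1 + s / d would do. *)
Local Notation tau := (s / d + d / s).

Lemma tau_ge2 : 2 <= tau.
Proof.
rewrite -subr_ge0 (_ : tau - 2 = (s - d) ^+ 2 / (s * d)).
  by rewrite divr_ge0 ?sqr_ge0 // mulr_ge0 // ltW.
by field; rewrite !gt_eqF.
Qed.

(** Positivity of a matters at n = 0, because 0^0 is 1 while 0^b is 0 for b > 0. *)
Lemma natr_le_powR (n : nat) (a b : R) : 0 < a -> a <= b ->
  (n%:R : R) `^ a <= n%:R `^ b.
Proof.
case: n => [a0 le_ab|n _ le_ab]; last by rewrite ler_powR // ler1n.
by rewrite !powR0 // gt_eqF // (lt_le_trans a0).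
Qed.

(** * Points of low potential *)

Definition piece_count (m : 'I_M) (xs : seq 'cV[R]_p) :=
  count (fun x => `[< (psi m @` A) x >]) xs.

Lemma sum_piece_count xs : (forall x, x \in xs -> A x) ->
  (\sum_(m < M) piece_count m xs)%N = size xs.
Proof.
elim: xs => [|x xs IH] xsA; first by rewrite big1.
rewrite /piece_count /= big_split /= IH; last first.
  by move=> y y_xs; apply: xsA; rewrite inE y_xs orbT.
have [m [a Aa psi_a]] : exists m, exists2 a, A a & psi m a = x.
  by apply: A_psi; apply: xsA; rewrite mem_head.
rewrite (bigD1 m) //= (_ : `[< (psi m @` A) x >] = true); last first.
  by apply/asboolP; exists a.
rewrite big1 // => m' neq_m; apply/eqP; rewrite eqb0.
apply/negP => /asboolP[b Ab psi_b]; move/eqP: neq_m; apply.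
by apply: (psi_disjoint m' m b a) => //; rewrite psi_a psi_b.
Qed.

(** Pigeonhole with the Moran weights: if every piece held more than its share, the counts would sum
    to more than [size xs]. *)
Lemma sparse_piece xs : (forall x, x \in xs -> A x) ->
  exists m, (piece_count m xs)%:R <= rm m `^ d * (size xs)%:R.
Proof.
move=> xsA; apply: contrapT => dense.
have : \sum_(m < M) rm m `^ d * (size xs)%:R
    < \sum_(m < M) (piece_count m xs)%:R.
  apply: ltr_sum => [|m _]; last first.
    by rewrite ltNge; apply/negP => le_m; apply: dense; exists m.
  (* A strict inequality of sums requires a nonempty index type; otherwise the Moran sum would be
     0. *)
  apply: contraT; rewrite -all_predC => /allP no_m.
  move: moran; rewrite big_seq big1 => [/eqP|m /no_m //].
  by rewrite eq_sym oner_eq0.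
by rewrite -mulr_suml moran mul1r -natr_sum sum_piece_count // ltxx.
Qed.

(* Descend into a piece holding at most its share of the points: the other
   pieces contribute at most [D] per point, and the exponent of [rm] produced
   by rescaling, [d tau - s = d^2 / s], is positive. *)
Lemma low_potential_point : exists2 C : R, 0 <= C &
  forall xs : seq 'cV[R]_p, (forall x, x \in xs -> A x) ->
  exists2 y, A y & y \notin xs /\
    \sum_(x <- xs) riesz y x <= C * (size xs)%:R `^ tau.
Proof.
(* q bounds the factor r_m^(d^2 / s) of every piece. *)
pose q := rho `^ (d * d / s).
have dds_gt0 : 0 < d * d / s by rewrite divr_gt0 ?mulr_gt0.
have q1 : q < 1 by exact: powR_lt1.
(* C solves C q + D = C: C q pays for the points in the chosen piece and D for those outside, which
   closes the induction. *)
pose C := D / (1 - q).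
have C0 : 0 <= C by rewrite divr_ge0 ?powR_ge0 // subr_ge0 ltW.
exists C => // xs; have [n] := ubnP (size xs).
elim: n => // n IH in xs *; rewrite ltnS => le_n xsA.
have [a0 Aa0] := A_neq0.
case: (posnP (size xs)) => [/size0nil -> |xs_gt0].
  by exists a0 => //; split => //; rewrite big_nil mulr_ge0 // powR_ge0.
have [m m_sparse] := sparse_piece xs xsA.
(* Off the piece the value 0 is a placeholder, so that a total inverse [g] can be chosen. *)
have preimage x : exists a, (psi m @` A) x -> A a /\ psi m a = x.
  by case: (pselect ((psi m @` A) x)) => [[a Aa <-]|nx]; [exists a | exists 0].
have [g gP] := choice preimage.
pose inm x := `[< (psi m @` A) x >].
pose ys := [seq g x | x <- xs & inm x].
have size_ys : size ys = piece_count m xs by rewrite size_map size_filter.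
have pm_lt1 : rm m `^ d < 1.
  apply: powR_lt1 => //; rewrite rm_gt0 (le_lt_trans (rm_le m)) //.
  by case/andP: rho01.
(* Strict because r_m^d < 1 and [xs] is nonempty, so the induction hypothesis applies to the
   preimages [ys]. *)
have lt_ys : (size ys < size xs)%N.
  rewrite -(ltr_nat R) size_ys; apply: (le_lt_trans m_sparse).
  by rewrite gtr_pMl ?ltr0n.
have ysA y : y \in ys -> A y.
  by case/mapP => x; rewrite mem_filter => /andP[/asboolP/gP[]] ? _ _ ->.
have [z Az [z_ys le_z]] := IH ys (leq_trans lt_ys le_n) ysA.
exists (psi m z); first exact: psiA.
split.
  apply: contra z_ys => z_xs; apply/mapP; exists (psi m z).
    by rewrite mem_filter z_xs andbT; apply/asboolP; exists z.
  by apply: (psi_inj m); rewrite (gP (psi m z) _).2 //; exists z.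
rewrite (bigID inm) /=.
have in_le : \sum_(x <- xs | inm x) riesz (psi m z) x
    <= C * q * (size xs)%:R `^ tau.
  rewrite -big_filter.
  have -> : \sum_(x <- [seq x <- xs | inm x]) riesz (psi m z) x =
      rm m `^ (- s) * \sum_(y <- ys) riesz z y.
    rewrite big_map mulr_sumr big_seq [RHS]big_seq; apply: eq_bigr => x.
    rewrite mem_filter => /andP[/asboolP/gP[_ gx] _].
    by rewrite -{1}gx riesz_psi.
  apply: (@le_trans _ _
      (rm m `^ (- s) * (C * (rm m `^ d * (size xs)%:R) `^ tau))).
    rewrite ler_wpM2l ?powR_ge0 //; apply: (le_trans le_z).
    rewrite ler_wpM2l // ge0_ler_powR ?nnegrE ?mulr_ge0 ?powR_ge0 //.
      by rewrite (le_trans _ tau_ge2).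
    by rewrite size_ys.
  rewrite powRM ?powR_ge0 // -powRrM.
  rewrite mulrCA (mulrA (rm m `^ _)) -powRD; last first.
    by rewrite (gt_eqF (rm_gt0 m)) implybT.
  have -> : - s + d * tau = d * d / s by field; rewrite !gt_eqF.
  rewrite mulrA ler_wpM2r ?powR_ge0 // ler_wpM2l //.
  by case/andP: rho01 => rho0 _; apply: ge0_ler_powR; rewrite ?nnegrE // ltW.
have out_le : \sum_(x <- xs | ~~ inm x) riesz (psi m z) x
    <= D * (size xs)%:R `^ tau.
  apply: (@le_trans _ _ (\sum_(x <- xs) D)).
    rewrite big_mkcond big_seq [leRHS]big_seq; apply: ler_sum => x x_xs.
    case: ifPn => [/asboolPn nmx|_]; last exact: powR_ge0.
    have [m' [a Aa psi_a]] := A_psi x (xsA x x_xs).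
    rewrite -psi_a; apply: riesz_separated => //.
    by apply/eqP => mm'; apply: nmx; exists a => //; rewrite mm'.
  rewrite big_const_seq count_predT iter_addr_0 -[D *+ _]mulr_natr.
  rewrite ler_wpM2l ?powR_ge0 //.
  have := natr_le_powR (size xs) 1 tau ltr01.
  by rewrite powRr1 //; apply; rewrite (le_trans _ tau_ge2) // ler1n.
apply: (le_trans (lerD in_le out_le)).
rewrite -mulrDl ler_wpM2r ?powR_ge0 // le_eqVlt; apply/orP; left.
by apply/eqP; rewrite /C; field; lra.
Qed.

(** * Energies of lists and the minimal energy *)

Definition energy (xs : seq 'cV[R]_p) :=
  \sum_(x <- xs) \sum_(y <- xs) riesz x y.

Lemma energy_ge0 xs : 0 <= energy xs.
Proof. by apply: sumr_ge0 => x _; apply: sumr_ge0. Qed.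
#[local] Hint Resolve energy_ge0 : core.

Lemma riesz_energyE (N : nat) (x : 'I_N -> 'cV[R]_p) :
  riesz_energy s x = energy [seq x i | i <- enum 'I_N].
Proof.
rewrite /energy big_map big_enum; apply: eq_bigr => i _.
by rewrite big_map big_enum (bigD1 i) //= riesz_diag add0r.
Qed.

Lemma energy_cons y xs :
  energy (y :: xs) = energy xs + 2 * \sum_(x <- xs) riesz y x.
Proof.
rewrite /energy !big_cons riesz_diag add0r.
under [X in _ + X]eq_bigr do rewrite big_cons.
rewrite big_split /= (eq_bigr _ (fun x _ => rieszC x y)).
by ring.
Qed.

Definition configuration N (xs : seq 'cV[R]_p) :=
  [/\ uniq xs, (forall x, x \in xs -> A x) & size xs = N].

(** A low-potential point lies outside the given list, so any list of points of A can be
    extended. *)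
Lemma configuration_exists N : exists xs, configuration N xs.
Proof.
elim: N => [|N [xs [xs_uniq xsA xs_size]]]; first by exists [::].
have [C _ /(_ xs xsA)[y Ay [y_xs _]]] := low_potential_point.
exists (y :: xs); split; rewrite /= ?y_xs ?xs_size //.
by move=> x; rewrite inE => /predU1P[->|/xsA].
Qed.

Local Notation E := (min_riesz_energy s A).

Lemma energies_lbound N : has_lbound [set e | exists x : 'I_N -> 'cV[R]_p,
  [/\ injective x, (forall i, A (x i)) & e = riesz_energy s x]].
Proof. by exists 0 => _ [x [_ _ ->]]; rewrite riesz_energyE. Qed.

Lemma E_le N xs : configuration N xs -> E N <= energy xs.
Proof.
move=> [xs_uniq xsA <-]; apply: ge_inf; first exact: energies_lbound.
exists (tnth (in_tuple xs)); split.
- by apply/tuple_uniqP.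
- by move=> k; apply: xsA; exact: mem_tnth.
- by rewrite riesz_energyE map_tnth_enum.
Qed.

Lemma E_ge N B : (forall xs, configuration N xs -> B <= energy xs) -> B <= E N.
Proof.
move=> leB; apply: lb_le_inf => [|_ [x [x_inj xA ->]]].
  (* The infimum must range over a nonempty set, as [inf] of the empty set is 0. *)
  have [xs [xs_uniq xsA xs_size]] := configuration_exists N.
  rewrite -xs_size; exists (riesz_energy s (tnth (in_tuple xs))).
  exists (tnth (in_tuple xs)); split => //; first by apply/tuple_uniqP.
  by move=> k; apply: xsA; exact: mem_tnth.
rewrite riesz_energyE; apply: leB; split.
- by rewrite map_inj_uniq // enum_uniq.
- by move=> y /mapP[k _ ->].
- by rewrite size_map size_enum_ord.
Qed.

Lemma min_energy_ge0 N : 0 <= min_riesz_energy s A N.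
Proof. by apply: E_ge => xs _. Qed.

Lemma E_adherent N e : 0 < e ->
  exists2 xs, configuration N xs & energy xs <= E N + e.
Proof.
move=> e0; apply: contrapT => far.
have : E N + e <= E N; last by rewrite gerDl leNgt e0.
apply: E_ge => xs xs_conf; rewrite leNgt; apply/negP => /ltW le_xs.
by apply: far; exists xs.
Qed.

(** Adding a low-potential point to N points costs twice its potential, since pairs are ordered,
    hence O(N^tau). Each of the k additions is charged at the final size N + k. *)
Lemma min_energy_add : exists2 C : R, 0 <= C & forall N k,
  min_riesz_energy s A (N + k)
    <= min_riesz_energy s A N + k%:R * (C * (N + k)%:R `^ tau).
Proof.
have [C C0 E_succ] : exists2 C : R, 0 <= C &
    forall N, E N.+1 <= E N + C * N%:R `^ tau.
  have [C C0 CP] := low_potential_point.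
  exists (2 * C) => [|N]; first exact: mulr_ge0.
  rewrite -lerBlDr; apply: E_ge => xs [xs_uniq xsA xs_size].
  have [y Ay [y_xs le_y]] := CP xs xsA.
  rewrite lerBlDr; apply: le_trans (E_le _ (y :: xs) _) _.
    split; rewrite /= ?y_xs ?xs_size //.
    by move=> x; rewrite inE => /predU1P[->|/xsA].
  by rewrite energy_cons lerD2l -mulrA ler_wpM2l // -xs_size.
exists C => // N k.
suff : forall j, (j <= k)%N ->
    E (N + j) <= E N + j%:R * (C * (N + k)%:R `^ tau) by exact.
elim=> [|j IH] lt_j; first by rewrite addn0 mul0r addr0.
rewrite addnS; apply: (le_trans (E_succ _)).
rewrite -[j.+1%:R]natr1 mulrDl mul1r addrA.
apply: lerD; first exact: IH (ltnW lt_j).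
rewrite ler_wpM2l ?mulr_ge0 //; apply: ge0_ler_powR; rewrite ?nnegrE //.
  by rewrite (le_trans _ tau_ge2).
by rewrite ler_nat; lia.
Qed.

(** Place a near-minimal configuration in each piece. Scaling multiplies its energy by r_m^(-s), and
    points in different pieces interact by at most D. *)
Lemma min_energy_pieces (n : 'I_M -> nat) :
  min_riesz_energy s A (\sum_(m < M) n m)%N
    <= \sum_(m < M) rm m `^ (- s) * min_riesz_energy s A (n m)
       + D * (\sum_(m < M) n m)%:R ^+ 2.
Proof.
pose S := \sum_(m < M) rm m `^ (- s).
have S0 : 0 <= S by apply: sumr_ge0 => m _; exact: powR_ge0.
apply/ler_addgt0Pr => e e0.
(* The errors are weighted by r_m^(-s), in total S, so they add up to at most e; the 1 keeps the
   denominator positive. *)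
have e'0 : 0 < e / (S + 1) by rewrite divr_gt0 // ltr_wpDl.
have near_min m : exists xs, configuration (n m) xs /\
    energy xs <= E (n m) + e / (S + 1).
  by have [xs ? ?] := E_adherent (n m) _ e'0; exists xs.
have [xs xsP] := choice near_min.
have xsA m x : x \in xs m -> A x by have [[_ /(_ x)]] := xsP m.
pose L := [seq psi m x | m <- enum 'I_M, x <- xs m].
have L_conf : configuration (\sum_(m < M) n m)%N L.
  split.
  - apply: allpairs_uniq_dep; first exact: enum_uniq.
      by move=> m _; have [[]] := xsP m.
    move=> _ _ /allpairsPdep[m [x [_ x_xs ->]]]
      /allpairsPdep[m' [y [_ y_xs ->]]] /= psi_xy.
    have mm' : m = m'.
      exact: psi_disjoint (xsA _ _ x_xs) (xsA _ _ y_xs) psi_xy.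
    by subst m'; rewrite (psi_inj m _ _ psi_xy).
  - by move=> _ /allpairsPdep[m [x [_ /xsA Ax ->]]]; exact: psiA.
  - rewrite size_allpairs_dep sumnE big_map big_enum.
    by apply: eq_bigr => m _; have [[]] := xsP m.
apply: (le_trans (E_le _ _ L_conf)).
have size_xs m : size (xs m) = n m by have [[]] := xsP m.
pose I m m' := \sum_(x <- xs m) \sum_(y <- xs m') riesz (psi m x) (psi m' y).
have -> : energy L = \sum_(m < M) \sum_(m' < M) I m m'.
  rewrite /energy /L big_allpairs_dep big_enum; apply: eq_bigr => m _.
  rewrite exchange_big /= big_allpairs_dep big_enum; apply: eq_bigr => m' _.
  by rewrite exchange_big.
have diag m : I m m <= rm m `^ (- s) * (E (n m) + e / (S + 1)).
  apply: (@le_trans _ _ (rm m `^ (- s) * energy (xs m))).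
    rewrite /energy /I mulr_sumr ler_sum // => x _.
    by rewrite mulr_sumr ler_sum // => y _; rewrite riesz_psi.
  by rewrite ler_wpM2l ?powR_ge0 //; have [] := xsP m.
have off_diag m m' : m' != m -> I m m' <= D * ((n m)%:R * (n m')%:R).
  move=> neq_m; rewrite -(size_xs m) -(size_xs m').
  apply: (@le_trans _ _ (\sum_(x <- xs m) \sum_(y <- xs m') D)).
    rewrite /I big_seq [leRHS]big_seq; apply: ler_sum => x /xsA Ax.
    rewrite big_seq [leRHS]big_seq; apply: ler_sum => y /xsA Ay.
    by apply: riesz_separated; rewrite // eq_sym.
  rewrite !big_const_seq !count_predT !iter_addr_0 -mulrnA.
  by rewrite -[D *+ _]mulr_natr natrM mulrC [(size (xs m'))%:R * _]mulrC mulrC.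
(* The bound on the cross terms is extended to m' = m, so that it sums to D times a full square. *)
apply: (@le_trans _ _ (\sum_(m < M) (rm m `^ (- s) * (E (n m) + e / (S + 1)) +
    \sum_(m' < M) D * ((n m)%:R * (n m')%:R)))).
  apply: ler_sum => m _; rewrite (bigD1 m) //=; apply: lerD; first exact: diag.
  rewrite [leRHS](bigD1 m) //= ler_wpDl ?mulr_ge0 ?powR_ge0 //.
  by apply: ler_sum => m' neq_m; exact: off_diag.
rewrite big_split /= [leRHS]addrAC; apply: lerD.
  under eq_bigr do rewrite mulrDr; rewrite big_split /= lerD2l -mulr_suml.
  rewrite mulrA ler_pdivrMr ?ltr_wpDl // mulrC ler_wpM2l ?(ltW e0) //.
  by rewrite lerDl.
rewrite natr_sum expr2 mulr_suml mulr_sumr ler_sum // => m _.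
by rewrite -mulr_sumr -mulr_sumr.
Qed.

(** Fill the pieces first, then add the at most M missing points. The interaction term of order N^2
    is absorbed by N^tau since tau >= 2. *)
Lemma min_energy_scaling : exists2 C : R, 0 <= C &
  forall (n : 'I_M -> nat) (N : nat),
    (\sum_(m < M) n m <= N)%N -> (N <= \sum_(m < M) n m + M)%N ->
    min_riesz_energy s A N
      <= \sum_(m < M) rm m `^ (- s) * min_riesz_energy s A (n m)
         + C * N%:R `^ tau.
Proof.
have [C C0 E_add] := min_energy_add.
exists (D + M%:R * C) => [|n N le_N N_le].
  by rewrite addr_ge0 ?powR_ge0 // mulr_ge0.
rewrite -(subnKC le_N); apply: (le_trans (E_add _ _)); rewrite subnKC //.
apply: (le_trans (lerD (min_energy_pieces n) (lexx _))).
rewrite -addrA lerD2l mulrDl; apply: lerD.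
  rewrite ler_wpM2l ?powR_ge0 //.
  apply: le_trans (natr_le_powR N 2 tau _ tau_ge2) => //.
  by rewrite powR_mulrn // lerXn2r ?nnegrE // ler_nat.
rewrite -mulrA ler_wpM2r ?mulr_ge0 ?powR_ge0 // ler_nat; lia.
Qed.

End FractalEnergy.

(** * Convergence along the scales *)

Lemma powR_continuous (R : realType) (a x : R) :
  0 < x -> y `^ a @[y --> x] --> x `^ a.
Proof.
move=> x0; suff : {for x, continuous (fun y : R => y `^ a)} by [].
apply: differentiable_continuous; apply/derivable1_diffP.
by apply: derivable_powR; rewrite in_itv /= x0.
Qed.

Lemma exprn_powR (R : realType) (x a : R) (n : nat) :
  0 <= x -> (x ^+ n) `^ a = (x `^ a) ^+ n.
Proof. by move=> x0; rewrite -!powR_mulrn ?powR_ge0 // powRAC. Qed.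

(** Truncation loses at most 1, that is u^(-n) after the division. *)
Lemma truncn_expr_div_cvg (R : realType) (c u : R) :
  0 <= c -> 1 < u -> (Num.truncn (c * u ^+ n))%:R / u ^+ n @[n --> \oo] --> c.
Proof.
move=> c0 u1; have u0 : 0 < u by lra.
have uV_cvg : c - u^-1 ^+ n @[n --> \oo] --> c.
  rewrite -[X in _ --> X]subr0; apply: cvgB; first exact: cvg_cst.
  by apply: cvg_expr; rewrite ger0_norm ?invr_ge0 ?(ltW u0) // invf_lt1.
apply: (squeeze_cvgr _ uV_cvg (cvg_cst c)).
near=> n; have un0 : 0 < u ^+ n by rewrite exprn_gt0.
have cun0 : 0 <= c * u ^+ n by rewrite mulr_ge0 // ltW.
have /andP[le_t lt_t] := truncn_itv cun0.
rewrite ler_pdivlMr // ler_pdivrMr // le_t andbT mulrBl exprVn mulVf ?gt_eqF //.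
by rewrite lerBlDr natr1 ltW.
Unshelve. all: by end_near.
Qed.

(** By monotonicity, an element of S above N n0 can only be N n with n > n0. *)
Lemma cvg_within_range (T : topologicalType) (f : nat -> T) (N : nat -> nat)
    (S : set nat) (g : T) :
  {homo N : m n / (m <= n)%N} -> S `<=` range N ->
  f (N n) @[n --> \oo] --> g -> f n @[n --> within S \oo] --> g.
Proof.
move=> N_homo SN fN U /fN [n0 _ n0U]; exists (N n0).+1 => // k /= lt_k Sk.
have [n _ def_k] := SN k Sk; rewrite -def_k; apply: n0U => /=.
rewrite leqNgt; apply/negP => /ltnW/N_homo.
by rewrite def_k leqNgt lt_k.
Qed.

(** For d <= 0 each of the M >= 2 terms would be at least 1. *)
Lemma moran_dimension_gt0 (R : realType) (M : nat) (rm : 'I_M -> R) (d : R) :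
  (1 < M)%N -> (forall m, 0 < rm m < 1) -> is_fractal_dimension rm d -> 0 < d.
Proof.
move=> M_gt1 rm01 moran; rewrite ltNge; apply/negP => d_le0.
have : (1 : R) < 1; last by rewrite ltxx.
rewrite -[X in _ < X]moran; apply: (@lt_le_trans _ _ M%:R).
  by rewrite ltr1n.
rewrite -[M in M%:R]card_ord -sum1_card natr_sum; apply: ler_sum => m _.
have /andP[m0 m1] := rm01 m.
rewrite -(opprK d) powRN invf_ge1 ?powR_gt0 //.
have : rm m `^ (- d) <= 1 `^ (- d).
  by apply: ge0_ler_powR; rewrite ?nnegrE ?oppr_ge0 ?ler01 // ltW.
by rewrite powR1.
Qed.

(** * The renewal inequality for the scaled energies *)

Section ScaledEnergy.
Variables (R : realType) (p M : nat) (A : set 'cV[R]_p).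
Variables (psi : 'I_M -> 'cV[R]_p -> 'cV[R]_p) (rm : 'I_M -> R).
Hypothesis hA : self_similar_fractal psi rm A.
Variables (r : R) (i : 'I_M -> nat).
Hypothesis hr : 0 < r < 1.
Hypothesis hi : forall k, (0 < i k)%N.
Hypothesis hgcd : \big[gcdn/0%N]_(k < M) i k = 1%N.
Hypothesis hrm : forall k, rm k = r ^+ i k.
Variables (d s : R) (l : nat).
Hypothesis hd : is_fractal_dimension rm d.
Hypothesis hs : d < s.

Local Notation u := (r `^ (- d)).
Local Notation v := (r `^ (d + s)).
Local Notation Nseq := (fun n : nat => Num.truncn (l%:R * u ^+ n)).
Local Notation E := (min_riesz_energy s A).

(** Piece m receives N_(n - i_m) points. Before truncation these counts are r_m^d l u^n, with sum l
    u^n by the Moran equation, and each of the M truncations loses less than 1. Multiplying by v^n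
    turns the factor r_m^(-s) into the weight r_m^d. *)
Lemma scaled_min_energy_cvg : cvgn (fun n => E (Nseq n) * v ^+ n).
Proof.
have [M_gt1 [spsi [A_neq0 [cA [A_pieces disjA]]]]] := hA.
have [r0 r1] := andP hr.
have rm01 m : 0 < rm m < 1 by case: (spsi m).
have rm_gt0 m : 0 < rm m by case/andP: (rm01 m).
have rm_le m : rm m <= r.
  by rewrite hrm -[leRHS]expr1 ler_wiXn2l // ltW.
have d_gt0 := moran_dimension_gt0 _ _ _ _ M_gt1 rm01 hd.
have s_gt0 : 0 < s by exact: lt_trans hs.
have [delta delta0 sep] := fractal_pieces_separated _ _ _ _ _ _ hA.
have psi_dist m x y := similitude_dist _ _ _ _ x y (spsi m).
(* The uniform bound [rho] on the ratios is r itself. *)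
have [C C0 E_le] := min_energy_scaling _ _ _ _ _ _ _ _ _ _
  A_neq0 A_pieces psi_dist delta0 sep
  rm_gt0 rm_le hr hd d_gt0 hs.
have E_ge0 := min_energy_ge0 _ _ _ _ _ _ _ _ _ _
  A_neq0 A_pieces psi_dist delta0 sep
  rm_gt0 rm_le hr hd d_gt0 hs.
pose tau := s / d + d / s.
have u_gt0 : 0 < u by rewrite powR_gt0.
have weight_u m : rm m `^ d * u ^+ i m = 1.
  rewrite hrm exprn_powR ?(ltW r0) // -exprMn powRN.
  by rewrite divff ?expr1n // gt_eqF ?powR_gt0.
have weight_v m : rm m `^ (- s) * v ^+ i m = rm m `^ d.
  rewrite hrm -exprn_powR ?(ltW r0) // -powRD; last first.
    by apply/implyP => _; rewrite gt_eqF ?exprn_gt0.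
  by congr powR; ring.
have a_ge0 n : 0 <= l%:R * u ^+ n by rewrite mulr_ge0 // exprn_ge0 // ltW.
have a_shift m n : (i m <= n)%N ->
    l%:R * u ^+ (n - i m) = rm m `^ d * (l%:R * u ^+ n).
  move=> le_n; rewrite -[in RHS](subnK le_n) exprD.
  by rewrite -[LHS]mul1r -(weight_u m); ring.
(* The error (l u^n)^tau v^n equals l^tau q^n, and q = r^(d (s - d) / s) is below 1 because d <
   s. *)
pose q := u `^ tau * v.
have q01 : 0 < q < 1.
  rewrite mulr_gt0 ?powR_gt0 //= /q -powRrM -powRD; last first.
    by apply/implyP => _; rewrite gt_eqF.
  have -> : - d * tau + (d + s) = d * (s - d) / s.
    by rewrite /tau; field; rewrite !gt_eqF.
  by apply: powR_lt1 => //; rewrite divr_gt0 // mulr_gt0 // subr_gt0.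
apply: (subrenewal_geometric_cvg _ _ (fun m => rm m `^ d) i _ hd hi hgcd
  _ (C * l%:R `^ tau) q) => //.
- by move=> m; rewrite powR_gt0.
- by rewrite mulr_ge0 // powR_ge0.
- by move=> n; rewrite mulr_ge0 // exprn_ge0 // powR_ge0.
move=> n le_n.
have le_i m : (i m <= n)%N by apply: leq_trans le_n; exact: leq_bigmax.
have sum_a : \sum_(m < M) l%:R * u ^+ (n - i m)%N = l%:R * u ^+ n.
  under eq_bigr do rewrite a_shift //.
  by rewrite -mulr_suml [X in X * _]hd mul1r.
have sum_le : (\sum_(m < M) Nseq (n - i m) <= Nseq n)%N.
  rewrite truncn_ge_nat // natr_sum -sum_a; apply: ler_sum => m _.
  by case/andP: (truncn_itv (a_ge0 (n - i m)%N)).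
have le_sum : (Nseq n <= \sum_(m < M) Nseq (n - i m) + M)%N.
  rewrite -(ler_nat R); have /andP[le_a _] := truncn_itv (a_ge0 n).
  apply: (le_trans le_a); rewrite -sum_a -[M in (_ + M)%N]card_ord -sum1_card.
  rewrite -big_split /= natr_sum; apply: ler_sum => m _.
  by rewrite addn1; case/andP: (truncn_itv (a_ge0 (n - i m)%N)) => _ /ltW.
have v_ge0 k : 0 <= v ^+ k by rewrite exprn_ge0 // powR_ge0.
apply: (le_trans (ler_wpM2r (v_ge0 n) (E_le _ _ sum_le le_sum))).
rewrite mulrDl; apply: lerD.
  rewrite mulr_suml; apply: ler_sum => m _.
  have -> : v ^+ n = v ^+ (n - i m) * v ^+ i m by rewrite -exprD subnK.
  by rewrite -weight_v le_eqVlt; apply/orP; left; apply/eqP; ring.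
rewrite -!mulrA ler_wpM2l // /q exprMn mulrA ler_wpM2r //.
rewrite -(exprn_powR _ u tau) ?(ltW u_gt0) // -powRM ?exprn_ge0 ?(ltW u_gt0) //.
apply: ge0_ler_powR; rewrite ?nnegrE //.
  by rewrite addr_ge0 // divr_ge0 // ltW.
by case/andP: (truncn_itv (a_ge0 n)).
Qed.

End ScaledEnergy.

Theorem theorem4p1 (R : realType) (p M : nat) (A : set 'cV[R]_p)
    (psi : 'I_M -> 'cV[R]_p -> 'cV[R]_p) (rm : 'I_M -> R)
    (hA : self_similar_fractal psi rm A)
    (r : R) (hr : 0 < r < 1) (i : 'I_M -> nat)
    (hi : forall k, (0 < i k)%N)
    (hgcd : \big[gcdn/0%N]_(k < M) i k = 1%N)
    (hrm : forall k, rm k = r ^+ i k)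
    (d : R) (hd : is_fractal_dimension rm d)
    (s : R) (hs : d < s) (l : nat) (hl : (0 < l)%N) :
  exists g : R,
    min_riesz_energy s A N / (N%:R `^ (1 + s / d))
      @[N --> within (scale_set r d l) \oo] --> g.
Proof.
have [M_gt1 [spsi _]] := hA.
have [r0 r1] := andP hr.
have d_gt0 : 0 < d.
  by apply: (moran_dimension_gt0 _ _ _ _ M_gt1 _ hd) => m; case: (spsi m).
have := scaled_min_energy_cvg _ _ _ _ _ _ hA _ _ hr hi hgcd hrm _ _ l hd hs.
set u := r `^ (- d); set v := r `^ (d + s) => /cvg_ex[/= L E_cvg].
have u_gt0 : 0 < u by rewrite powR_gt0.
have u_gt1 : 1 < u.
  by rewrite /u powRN invf_gt1 ?powR_gt0 // powR_lt1.
pose Nseq n := Num.truncn (l%:R * u ^+ n).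
(* N_n is asymptotic to l u^n, whence the factor l^(1 + s/d). *)
exists (L / l%:R `^ (1 + s / d)).
apply: (cvg_within_range _ _ Nseq).
- move=> m n le_mn; apply: le_truncn; rewrite ler_wpM2l //.
  by apply: ler_weXn2l => //; exact: ltW.
(* [scale_set] takes n from 1 on, while [Nseq] also has the index 0; an inclusion is all that is
   claimed. *)
- move=> _ [n _ <-]; exists n => //; rewrite /Nseq /u.
  by rewrite -powR_mulrn ?powR_ge0 // -powRrM mulNr [d * _]mulrC.
have l_gt0 : 0 < (l%:R : R) by rewrite ltr0n.
have v_gt0 n : 0 < v ^+ n by rewrite exprn_gt0 // powR_gt0.
(* Since u^(1 + s/d) = 1 / v, multiplying by v^n amounts to dividing N_n by u^n inside the power. *)
have normalize n : (Nseq n)%:R `^ (1 + s / d) * v ^+ n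
    = ((Nseq n)%:R / u ^+ n) `^ (1 + s / d).
  rewrite powRM ?invr_ge0 ?exprn_ge0 ?(ltW u_gt0) //; congr (_ * _).
  rewrite -powR_inv1 ?exprn_ge0 ?(ltW u_gt0) // powRAC.
  rewrite exprn_powR ?(ltW u_gt0) //.
  rewrite exprn_powR ?powR_ge0 // -!powRrM /v; congr (_ `^ _ ^+ n).
  by field; rewrite gt_eqF.
have -> : (fun n => min_riesz_energy s A (Nseq n) / (Nseq n)%:R `^ (1 + s / d))
    = (fun n => (min_riesz_energy s A (Nseq n) * v ^+ n) /
                ((Nseq n)%:R / u ^+ n) `^ (1 + s / d)).
  apply/funext => n; rewrite -normalize invfM mulrACA divff ?mulr1 //.
  by rewrite gt_eqF.
apply: cvgM; first exact: E_cvg.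
apply: cvgV; first by rewrite gt_eqF // powR_gt0.
apply: (@cvg_comp _ _ _
  (fun n => (Nseq n)%:R / u ^+ n) (fun x => x `^ (1 + s / d))
  _ (nbhs (l%:R : R))); last exact: powR_continuous.
by apply: truncn_expr_div_cvg.
Qed.
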